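(* Let $f: A\rightarrow B$ be a ring homomorphism and let $J$ be a proper ideal of $B$. Let $A\bowtie^{f}J=\{(a,f(a)+j) : a\in A,\ j\in J\}\subseteq A\times B$, and let $f(A)+J$ denote the subring $\{f(a)+j : a\in A,\ j\in J\}$ of $B$. (1) If $A\bowtie^{f}J$ is a coherent ring, then so is $A$. (2) Assume that $J$ and $f^{-1}(J)$ are finitely generated ideals of $f(A)+J$ and $A$ respectively. Then $A\bowtie^{f}J$ is a coherent ring if and only if $A$ and $f(A)+J$ are coherent rings. (3) Assume that $J$ is a regular finitely generated ideal of $f(A)+J$. Then $A\bowtie^{f}J$ is a coherent ring if and only if $A$ and $f(A)+J$ are coherent rings and $f^{-1}(J)$ is a finitely generated ideal of $A$.
   Context: All rings are commutative with identity and all modules are unitary. $A\bowtie^{f}J$ is a subring of $A\times B$ (with componentwise operations), called the amalgamation of $A$ with $B$ along $J$ with respect to $f$. Since $J$ is an ideal of $B$ contained in $f(A)+J$, it is also an ideal of the ring $f(A)+J$. An ideal of a ring $R$ is regular if it contains a regular element of $R$, i.e. a non-zerodivisor of $R$. A ring $R$ is coherent if every finitely generated ideal of $R$ is finitely presented as an $R$-module. *)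

(* Defs.v *)
From HB Require Import structures.
From mathcomp Require Import all_boot all_order all_algebra.
From mathcomp Require Import boolp.

Set Implicit Arguments.
Unset Strict Implicit.
Unset Printing Implicit Defensive.

Import GRing.Theory.
Local Open Scope ring_scope.

Record submodule_of (R : pzRingType) (V : lmodType R) (S : {pred V}) :=
  Submodule { submodule_val : V; _ : submodule_val \in S }.

HB.instance Definition _ (R : pzRingType) (V : lmodType R) (S : {pred V}) :=
  [isSub for @submodule_val R V S].
HB.instance Definition _ (R : pzRingType) (V : lmodType R) (S : {pred V}) :=
  [Choice of submodule_of S by <:].
HB.instance Definition _ (R : pzRingType) (V : lmodType R)
    (S : submodClosed V) :=
  [SubChoice_isSubLmodule of submodule_of S by <:].

Record subring_of (R : comPzRingType) (S : {pred R}) :=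
  Subring { subring_val : R; _ : subring_val \in S }.

HB.instance Definition _ (R : comPzRingType) (S : {pred R}) :=
  [isSub for @subring_val R S].
HB.instance Definition _ (R : comPzRingType) (S : {pred R}) :=
  [Choice of subring_of S by <:].
HB.instance Definition _ (R : comPzRingType) (S : subringClosed R) :=
  GRing.SubChoice_isSubComPzRing.Build _ _ (subring_of S) (subringClosedP _).

Section Finiteness.
Variable R : comPzRingType.

(* In particular N is then a submodule of M. *)
Definition fg_submodule (M : lmodType R) (N : {pred M}) : Prop :=
  exists (n : nat) (v : 'I_n -> M),
    forall x, x \in N <-> exists c : 'I_n -> R, x = \sum_(i < n) c i *: v i.

Definition finitely_presented (M : lmodType R) : Prop :=
  exists (n : nat) (g : {linear 'rV[R]_n -> M}),
    (forall m, exists u, g u = m) /\ fg_submodule [pred u | g u == 0].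

(* Ideals of R are the submodules of the regular module R^o. *)
Definition fg_ideal (I : {pred R}) : Prop := fg_submodule (I : {pred R^o}).

(* On a commutative ring, GRing.lreg is "non-zerodivisor". *)
Definition regular_ideal (I : {pred R}) : Prop :=
  exists2 x, x \in I & GRing.lreg x.

(* The unit ideal is allowed, so the library's idealr (proper ideals of
   nontrivial rings) is not what is wanted here. *)
Definition coherent : Prop :=
  forall I : submodClosed R^o, fg_ideal I -> finitely_presented (submodule_of I).

End Finiteness.

Section Amalgamation.
(* idealr B is the library's type of proper ideals; it requires B nontrivial,
   which the existence of a proper ideal forces anyway. *)
Variables (A : comPzRingType) (B : comNzRingType).
Variables (f : {rmorphism A -> B}) (J : idealr B).

Definition amalg : pred (A * B) :=
  fun x => `[< exists a j, j \in J /\ x = (a, f a + j) >].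

Definition image_add : pred B :=
  fun b => `[< exists a j, j \in J /\ b = f a + j >].

Fact amalg_subring : subring_closed amalg.
Proof.
split=> [|x y|x y].
- by apply/asboolP; exists 1, 0; rewrite rpred0 rmorph1 addr0.
- move=> /asboolP[a [j [Jj ->]]] /asboolP[b [k [Jk ->]]].
  apply/asboolP; exists (a - b), (j - k); split; first exact: rpredB.
  by apply: (congr1 (pair _)); rewrite /= rmorphB opprD addrACA.
- move=> /asboolP[a [j [Jj ->]]] /asboolP[b [k [Jk ->]]].
  apply/asboolP; exists (a * b), (f a * k + (f b + k) * j); split.
    by rewrite rpredD // idealMr.
  by apply: (congr1 (pair _)); rewrite /= rmorphM mulrDl mulrDr addrA (mulrC j).
Qed.
HB.instance Definition _ := GRing.isSubringClosed.Build _ amalg amalg_subring.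

Fact image_add_subring : subring_closed image_add.
Proof.
split=> [|x y|x y].
- by apply/asboolP; exists 1, 0; rewrite rpred0 rmorph1 addr0.
- move=> /asboolP[a [j [Jj ->]]] /asboolP[b [k [Jk ->]]].
  apply/asboolP; exists (a - b), (j - k); split; first exact: rpredB.
  by rewrite rmorphB opprD addrACA.
- move=> /asboolP[a [j [Jj ->]]] /asboolP[b [k [Jk ->]]].
  apply/asboolP; exists (a * b), (f a * k + (f b + k) * j); split.
    by rewrite rpredD // idealMr.
  by rewrite rmorphM mulrDl mulrDr addrA (mulrC j).
Qed.
HB.instance Definition _ :=
  GRing.isSubringClosed.Build _ image_add image_add_subring.

(* J viewed as an ideal of the ring f(A) + J *)
Definition ideal_in_image_add : {pred subring_of image_add} :=
  [pred x | val x \in J].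

End Amalgamation.

Arguments ideal_in_image_add {A B} f J _ /.

(* Main.v *)
(** Coherence means that the relations between finitely many ring elements form
    a finitely generated module.  The amalgamation R projects onto A with kernel
    0 x J and onto C = f(A) + J with kernel f^-1(J) x 0, and these two kernels
    meet in 0.  (1) A is a retract of R through a |-> (a, f a), so relations over
    A lift to R and come back.  (2) C is a quotient of R by a finitely generated
    ideal, which preserves coherence.  Conversely, let r be a tuple in R.  Since
    A is coherent and 0 x J is finitely generated, the vectors u with u.r in
    0 x J are generated by the rows of some matrix U.  The entries of U r lie in
    0 x J, which embeds in C, so the relations between them are those between
    their images in C; they are finitely generated since C is coherent and
    f^-1(J) x 0 is finitely generated.  (3) If x in J is regular in C, then
    f^-1(J) x 0 is the annihilator of (0, x) in R, hence finitely generated when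
    R is coherent. *)
Require Import Defs.
From HB Require Import structures.
From mathcomp Require Import all_boot all_order all_algebra.
From mathcomp Require Import boolp.

Set Implicit Arguments.
Unset Strict Implicit.
Unset Printing Implicit Defensive.

Import GRing.Theory.
Local Open Scope ring_scope.

(** * Finite generation in matrix form *)

Definition fg_syzygies (R : comPzRingType) : Prop :=
  forall n (r : 'cV[R]_n), exists p (S : 'M[R]_(p, n)),
    S *m r = 0 /\ forall u : 'rV_n, u *m r = 0 -> exists c, u = c *m S.

(** The 1 x 1 matrix [x%:M] turns membership of [x] in the ideal spanned by the entries of [g] into
    a matrix equation. *)
Definition fg_kernel (R S : comPzRingType) (phi : {rmorphism R -> S}) : Prop :=
  exists m (g : 'cV[R]_m),
    map_mx phi g = 0 /\ forall x, phi x = 0 -> exists c, x%:M = c *m g.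

Section Generators.
Variable R : comPzRingType.

Lemma fg_idealP (I : {pred R}) :
  fg_ideal I <->
  exists m (g : 'cV[R]_m), forall x, x \in I <-> exists c, x%:M = c *m g.
Proof.
split=> [[m [v vP]]|[m [g gP]]].
- exists m, (\col_i v i) => x; rewrite vP; split=> [[c ->]|[c /matrixP/(_ 0 0)]].
    exists (\row_i c i); apply/matrixP=> i j; rewrite !ord1 !mxE mulr1n.
    by apply: eq_bigr => k _; rewrite !mxE.
  rewrite !mxE mulr1n => ->; exists (c 0).
  by apply: eq_bigr => k _; rewrite !mxE.
- exists m, (g^~ 0) => x; rewrite gP; split=> [[c /matrixP/(_ 0 0)]|[c ->]].
    by rewrite !mxE mulr1n => ->; exists (c 0).
  exists (\row_i c i); apply/matrixP=> i j; rewrite !ord1 !mxE mulr1n.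
  by apply: eq_bigr => k _; rewrite !mxE.
Qed.

Lemma fg_submodule_rowP n (N : {pred 'rV[R]_n}) :
  fg_submodule N <->
  exists m (S : 'M[R]_(m, n)), forall u, u \in N <-> exists c, u = c *m S.
Proof.
split=> [[m [v vP]]|[m [S SP]]].
- exists m, (\matrix_i v i) => u; rewrite vP; split=> [[c ->]|[c ->]].
    exists (\row_i c i); rewrite mulmx_sum_row.
    by apply: eq_bigr => k _; rewrite rowK mxE.
  exists (c 0); rewrite mulmx_sum_row.
  by apply: eq_bigr => k _; rewrite rowK.
- exists m, (fun i => row i S) => u; rewrite SP; split=> [[c ->]|[c ->]].
    by exists (c 0); rewrite mulmx_sum_row.
  exists (\row_i c i); rewrite mulmx_sum_row.
  by apply: eq_bigr => k _; rewrite mxE.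
Qed.

Lemma row_witnesses m n p (S : 'M[R]_(m, n)) (T : 'M[R]_(p, n)) :
  (forall i, exists c, row i S = c *m T) -> exists C, S = C *m T.
Proof.
move=> /fin_all_exists[C CP]; exists (\matrix_i C i).
by apply/row_matrixP=> i; rewrite CP row_mul rowK.
Qed.

(** * Coherence as finite generation of relations *)

Section SpanIdeal.
Variables (n : nat) (r : 'cV[R]_n).

Definition span_ideal : {pred R^o} := fun x => `[< exists c, x%:M = c *m r >].

Fact span_ideal_submod : submod_closed span_ideal.
Proof.
split=> [|a x y /asboolP[c cP] /asboolP[d dP]]; apply/asboolP.
  by exists 0; rewrite mul0mx raddf0.
exists (a *: c + d); rewrite mulmxDl -scalemxAl -cP -dP.
by rewrite raddfD /= scale_scalar_mx.
Qed.

HB.instance Definition _ :=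
  GRing.isSubmodClosed.Build R R^o span_ideal span_ideal_submod.

Lemma fg_span_ideal : fg_ideal span_ideal.
Proof. by apply/fg_idealP; exists n, r => x; split=> /asboolP. Qed.

End SpanIdeal.
End Generators.

(* The relations between the r_i do not depend on the presentation g of the
   ideal (r) up to finite generation: with q = g(basis), r = B q and q = Q r, a
   relation u satisfies u B in ker g and u = u (1 - B Q) + (u B) Q, as in
   Schanuel's lemma. *)
Lemma coherent_fg_syzygies (R : comPzRingType) : coherent R -> fg_syzygies R.
Proof.
move=> cohR n r.
have [m [g [g_surj /fg_submodule_rowP[p [K KP]]]]] := cohR _ (fg_span_ideal r).
pose q : 'cV[R]_m := \col_j val (g (delta_mx 0 j)).
have gZ a u : val (g (a *: u)) = a * val (g u) by rewrite linearZ linearZ.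
have gE u : (val (g u))%:M = u *m q.
  apply/matrixP=> i j; rewrite !ord1 !mxE mulr1n {1}[u]row_sum_delta.
  rewrite !raddf_sum; apply: eq_bigr => k _.
  by rewrite [q k 0]mxE; apply: gZ.
have kerP (u : 'rV_m) : u *m q = 0 <-> exists c, u = c *m K.
  apply: iff_trans (KP u); rewrite inE -gE.
  split=> [/matrixP/(_ 0 0)|/eqP->]; last by rewrite !raddf0.
  by rewrite !mxE mulr1n => gu0; apply/eqP/val_inj; rewrite gu0 raddf0.
have [B rE] : exists B, r = B *m q.
  apply: row_witnesses => i.
  have Ir : r i 0 \in span_ideal r.
    apply/asboolP; exists (delta_mx 0 i); rewrite -rowE.
    by apply/matrixP=> j k; rewrite !ord1 !mxE mulr1n.
  have [u gu] := g_surj (Submodule Ir); exists u; rewrite -gE gu.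
  by apply/matrixP=> j k; rewrite !ord1 !mxE mulr1n.
have [Q qE] : exists Q, q = Q *m r.
  apply: row_witnesses => j.
  have /asboolP[c cP] := valP (g (delta_mx 0 j)); exists c; rewrite -cP.
  by apply/matrixP=> i k; rewrite !ord1 !mxE mulr1n.
have Kq : K *m q = 0.
  apply/row_matrixP=> i; rewrite row_mul row0; apply/kerP.
  by exists (delta_mx 0 i); rewrite -rowE.
exists (n + p)%N, (col_mx (1%:M - B *m Q) (K *m Q)); split.
  by rewrite mul_col_mx mulmxBl mul1mx -!mulmxA -qE -rE subrr Kq col_mx0.
move=> u; rewrite {1}rE mulmxA => /kerP[c cP].
exists (row_mx u c); rewrite mul_row_col mulmxBr mulmx1 !mulmxA -cP.
by rewrite subrK.
Qed.

Section RowMap.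
Variables (R : comPzRingType) (I : submodClosed R^o) (n : nat) (v : 'cV[R]_n).
Hypothesis Iv : forall u : 'rV_n, (u *m v) 0 0 \in I.

Definition row_map (u : 'rV_n) : submodule_of I := Submodule (Iv u).

Fact row_map_linear : linear row_map.
Proof.
move=> a u w; apply: val_inj.
have -> : val (a *: row_map u + row_map w) =
    a * val (row_map u) + val (row_map w).
  by rewrite raddfD; congr (_ + _); apply: GRing.valZ.
by rewrite /= mulmxDl -scalemxAl !mxE.
Qed.

HB.instance Definition _ :=
  GRing.isLinear.Build R 'rV_n (submodule_of I) _ row_map row_map_linear.

End RowMap.

(** Generators [v] of an ideal give the surjection [row_map] from the free module, and its kernel is
    the module of relations of [v]. *)
Lemma fg_syzygies_coherent (R : comPzRingType) : fg_syzygies R -> coherent R.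
Proof.
move=> syzR I /fg_idealP[n [v vP]].
have Iv (u : 'rV_n) : (u *m v) 0 0 \in I.
  by apply/vP; exists u; rewrite -mx11_scalar.
exists n, (row_map Iv); split=> [x|].
  have /vP[c cP] := valP x; exists c; apply: val_inj.
  by rewrite /= -cP mxE mulr1n.
apply/fg_submodule_rowP; have [p [S [Sv SP]]] := syzR n v.
exists p, S => u; rewrite inE; split=> [/eqP/(congr1 val)|[c ->]].
  by rewrite raddf0 /= => uv0; apply: SP; rewrite [LHS]mx11_scalar uv0 raddf0.
by apply/eqP/val_inj; rewrite raddf0 /= -mulmxA Sv mulmx0 mxE.
Qed.

Lemma coherentE (R : comPzRingType) : coherent R <-> fg_syzygies R.
Proof. by split; [apply: coherent_fg_syzygies|apply: fg_syzygies_coherent]. Qed.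

(** * Relations along a surjection; [s] is only a set-theoretic section *)

Section Surjection.
Variables (R S : comPzRingType) (phi : {rmorphism R -> S}).
Variables (s : S -> R) (sK : cancel s phi).
Local Notation "M ^phi" := (map_mx phi M) (at level 2, format "M ^phi").

Lemma map_mx_section m n (M : 'M[S]_(m, n)) : (map_mx s M)^phi = M.
Proof. by apply/matrixP=> i j; rewrite !mxE. Qed.

(** The vectors killed by [phi] form the n-th power of its kernel, so a block diagonal matrix of
    copies of [g] generates them. *)
Lemma fg_kernel_row n : fg_kernel phi ->
  exists p (W : 'M[R]_(p, n)), W^phi = 0 /\
    forall u : 'rV_n, u^phi = 0 -> exists c, u = c *m W.
Proof.
case=> m [g [g0 gP]].
elim: n => [|n [p [W [W0 WP]]]].
  by exists 0, 0; split=> [|u _]; [apply: map_mx0|exists 0; rewrite !thinmx0].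
exists (m + p)%N, (block_mx g 0 0 W); split.
  by rewrite (map_block_mx phi g) g0 W0 !map_mx0 block_mx0.
rewrite -[n.+1]/(1 + n)%N => u; rewrite -[u]hsubmxK map_row_mx -row_mx0.
case/eq_row_mx=> /matrixP/(_ 0 0); rewrite !mxE => /gP[c cP] /WP[d dP].
exists (row_mx c d); rewrite mul_row_block !mulmx0 addr0 add0r -dP -cP.
by congr row_mx; rewrite [LHS]mx11_scalar mxE.
Qed.

Lemma fg_syzygies_mod_kernel n (r : 'cV[R]_n) :
    fg_syzygies S -> fg_kernel phi ->
  exists p (T : 'M[R]_(p, n)), (T *m r)^phi = 0 /\
    forall u : 'rV_n, (u *m r)^phi = 0 -> exists c, u = c *m T.
Proof.
move=> syzS /(fg_kernel_row n)[p [W [W0 WP]]].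
have [m [T [Tr TP]]] := syzS n r^phi.
exists (m + p)%N, (col_mx (map_mx s T) W); split.
  rewrite mul_col_mx map_col_mx !map_mxM W0 mul0mx map_mx_section Tr.
  by rewrite col_mx0.
move=> u; rewrite map_mxM => /TP[c cP].
(* The lift of [u^phi = c *m T] agrees with [u] only modulo the kernel of [phi]; [W] absorbs the
   difference. *)
have [|d dP] := WP (u - map_mx s c *m map_mx s T).
  by rewrite map_mxB map_mxM !map_mx_section -cP subrr.
by exists (row_mx (map_mx s c) d); rewrite mul_row_col -dP addrC subrK.
Qed.

(** Lift the tuple to [R] and append the kernel generators [g]. A relation over [S] lifts to a
    combination with value [c *m g], hence extends by [- c] to a true relation over [R]; dropping
    the last coordinates and applying [phi] gives it back. *)
Lemma fg_syzygies_quotient : fg_syzygies R -> fg_kernel phi -> fg_syzygies S.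
Proof.
move=> syzR [m [g [g0 gP]]] n r.
have [p [T [Tr TP]]] := syzR _ (col_mx (map_mx s r) g).
exists p, (lsubmx T)^phi; split.
  have /(congr1 (map_mx phi)) : lsubmx T *m map_mx s r + rsubmx T *m g = 0.
    by rewrite -mul_row_col hsubmxK.
  by rewrite map_mx0 map_mxD !map_mxM g0 mulmx0 addr0 map_mx_section.
move=> u ur0; set x := (map_mx s u *m map_mx s r) 0 0.
have xE : map_mx s u *m map_mx s r = x%:M by apply: mx11_scalar.
have /gP[c cP] : phi x = 0.
  have : map_mx phi (x%:M : 'M_1) = 0 by rewrite -xE map_mxM !map_mx_section.
  by move/matrixP/(_ 0 0); rewrite !mxE mulr1n.
have [|d /(congr1 (@lsubmx _ _ _ _))] := TP (row_mx (map_mx s u) (- c)).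
  by rewrite mul_row_col xE mulNmx -cP subrr.
rewrite row_mxKl -{1}[T]hsubmxK mul_mx_row row_mxKl => /(congr1 (map_mx phi)).
by rewrite map_mxM map_mx_section => ->; exists (map_mx phi d).
Qed.

End Surjection.

Lemma fg_syzygies_retract (R S : comPzRingType) (phi : {rmorphism R -> S})
    (iota : {rmorphism S -> R}) :
  cancel iota phi -> fg_syzygies R -> fg_syzygies S.
Proof.
move=> iotaK syzR n r; have [p [T [Tr TP]]] := syzR n (map_mx iota r).
exists p, (map_mx phi T); split.
  by rewrite -[r](map_mx_section iotaK) -map_mxM Tr map_mx0.
move=> u ur0; have [|c cP] := TP (map_mx iota u).
  by rewrite -map_mxM ur0 map_mx0.
by exists (map_mx phi c); rewrite -map_mxM -cP map_mx_section.
Qed.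

(** * Two homomorphisms whose kernels meet in 0 *)

Section JointlyInjective.
Variables (R S T : comPzRingType).
Variables (phi : {rmorphism R -> S}) (psi : {rmorphism R -> T}).
Hypothesis phi_psi_inj : forall x, phi x = 0 -> psi x = 0 -> x = 0.

Lemma jointly_injective_mx m n (M : 'M[R]_(m, n)) :
  map_mx phi M = 0 -> map_mx psi M = 0 -> M = 0.
Proof.
move=> /matrixP phiM /matrixP psiM; apply/matrixP=> i j; rewrite mxE.
by apply: phi_psi_inj; [move: (phiM i j)|move: (psiM i j)]; rewrite !mxE.
Qed.

Variables (t : T -> R) (tK : cancel t psi) (K : {pred T}).
Hypothesis KP : forall y, y \in K <-> exists2 x, phi x = 0 & psi x = y.

(** [psi] maps the kernel of [phi] bijectively onto [K], and coefficients lift from [T] to [R]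
    through [t], so generators transfer both ways. *)
Lemma fg_kernel_image : fg_kernel phi <-> fg_ideal K.
Proof.
split=> [[m [g [g0 gP]]]|/fg_idealP[m [h hP]]].
- apply/fg_idealP; exists m, (map_mx psi g) => y; split.
    case/KP=> x /gP[c xE] <-; exists (map_mx psi c).
    by rewrite -map_mxM -xE map_scalar_mx.
  case=> c yE; apply/KP; exists ((map_mx t c *m g) 0 0).
    have /matrixP/(_ 0 0) : map_mx phi (map_mx t c *m g) = 0.
      by rewrite map_mxM g0 mulmx0.
    by rewrite mxE [RHS]mxE.
  have /matrixP/(_ 0 0) : map_mx psi (map_mx t c *m g) = y%:M.
    by rewrite map_mxM map_mx_section.
  by rewrite mxE [RHS]mxE mulr1n.
- have /fin_all_exists2[k k0 kE] i : exists2 x, phi x = 0 & psi x = h i 0.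
    apply/KP/hP; exists (delta_mx 0 i); rewrite -rowE.
    by apply/matrixP=> j l; rewrite !ord1 !mxE mulr1n.
  have psik : map_mx psi (\col_i k i) = h.
    by apply/matrixP=> i j; rewrite !ord1 !mxE kE.
  have phik : map_mx phi (\col_i k i) = 0.
    by apply/matrixP=> i j; rewrite !mxE k0.
  exists m, (\col_i k i); split=> // x x0.
  have [c cE] : exists c, (psi x)%:M = c *m h by apply/hP/KP; exists x.
  exists (map_mx t c); apply: subr0_eq; apply: jointly_injective_mx.
    by rewrite map_mxB map_mxM phik mulmx0 subr0 map_scalar_mx x0 raddf0.
  by rewrite map_mxB map_mxM (map_mx_section tK) psik map_scalar_mx cE subrr.
Qed.

Lemma fg_syzygies_glue (s : S -> R) : cancel s phi ->
  fg_kernel phi -> fg_kernel psi ->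
  fg_syzygies S -> fg_syzygies T -> fg_syzygies R.
Proof.
move=> sK kphi kpsi syzS syzT n r.
have [p [U [Ur UP]]] := fg_syzygies_mod_kernel sK r syzS kphi.
have [q [V [Vr VP]]] := fg_syzygies_mod_kernel tK (U *m r) syzT kpsi.
exists q, (V *m U); split.
  (* The entries of [U *m r] lie in the kernel of [phi], where [psi] is injective, so vanishing can
     be tested after [psi]. *)
  rewrite -mulmxA; apply: jointly_injective_mx => //.
  by rewrite map_mxM Ur mulmx0.
move=> u ur0; have [|c uE] := UP u; first by rewrite ur0 map_mx0.
have [|d cE] := VP c; first by rewrite mulmxA -uE ur0 map_mx0.
by exists d; rewrite mulmxA -cE.
Qed.

End JointlyInjective.

(** * The amalgamation, its two projections and their kernels *)

Section Amalgamation.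
Variables (A : comPzRingType) (B : comNzRingType).
Variables (f : {rmorphism A -> B}) (J : idealr B).
Local Notation R := (subring_of (amalg f J)).
Local Notation C := (subring_of (image_add f J)).

Fact amalg_pair (a : A) (j : B) : j \in J -> (a, f a + j) \in amalg f J.
Proof. by move=> Jj; apply/asboolP; exists a, j. Qed.

Fact amalg_snd (x : R) : (val x).2 \in image_add f J.
Proof.
have /asboolP[a [j [Jj ->]]] := valP x.
by apply/asboolP; exists a, j.
Qed.

Lemma amalg_subJ (x : R) : (val x).2 - f (val x).1 \in J.
Proof. by have /asboolP[a [j [Jj ->]]] := valP x; rewrite addrC addKr. Qed.

Definition amalg_projA (x : R) : A := (val x).1.
Definition amalg_projC (x : R) : C := Subring (amalg_snd x).

Fact amalg_projA_zmod : zmod_morphism amalg_projA.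
Proof. by move=> x y; rewrite /amalg_projA rmorphB. Qed.
Fact amalg_projA_monoid : monoid_morphism amalg_projA.
Proof. by split=> [|x y]; rewrite /amalg_projA ?rmorph1 ?rmorphM. Qed.
HB.instance Definition _ :=
  GRing.isZmodMorphism.Build R A amalg_projA amalg_projA_zmod.
HB.instance Definition _ :=
  GRing.isMonoidMorphism.Build R A amalg_projA amalg_projA_monoid.

Fact amalg_projC_zmod : zmod_morphism amalg_projC.
Proof. by move=> x y; apply: val_inj; rewrite !rmorphB. Qed.
Fact amalg_projC_monoid : monoid_morphism amalg_projC.
Proof. by split=> [|x y]; apply: val_inj; rewrite ?rmorph1 ?rmorphM. Qed.
HB.instance Definition _ :=
  GRing.isZmodMorphism.Build R C amalg_projC amalg_projC_zmod.
HB.instance Definition _ :=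
  GRing.isMonoidMorphism.Build R C amalg_projC amalg_projC_monoid.

Fact amalg_diag_subproof (a : A) : (a, f a) \in amalg f J.
Proof. by rewrite -[f a]addr0 amalg_pair ?rpred0. Qed.
Definition amalg_diag (a : A) : R := Subring (amalg_diag_subproof a).

Fact amalg_diag_zmod : zmod_morphism amalg_diag.
Proof.
move=> x y; apply: val_inj; rewrite [RHS]rmorphB.
by apply: (congr1 (pair _)); rewrite /= rmorphB.
Qed.
Fact amalg_diag_monoid : monoid_morphism amalg_diag.
Proof.
split=> [|x y]; apply: val_inj.
  by rewrite [RHS]rmorph1; apply: (congr1 (pair _)); rewrite /= rmorph1.
by rewrite [RHS]rmorphM; apply: (congr1 (pair _)); rewrite /= rmorphM.
Qed.
HB.instance Definition _ :=
  GRing.isZmodMorphism.Build A R amalg_diag amalg_diag_zmod.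
HB.instance Definition _ :=
  GRing.isMonoidMorphism.Build A R amalg_diag amalg_diag_monoid.

Lemma amalg_diagK : cancel amalg_diag amalg_projA.
Proof. by []. Qed.

(** An element of f(A) + J does not determine its summand from A, so a preimage is picked by
    choice. *)
Lemma amalg_projC_section : exists t, cancel t amalg_projC.
Proof.
suff /choice[t tP] : forall c, exists x, amalg_projC x = c by exists t.
move=> c; have /asboolP[a [j [Jj cE]]] := valP c.
by exists (Subring (amalg_pair a Jj)); apply: val_inj; rewrite /= -cE.
Qed.

Lemma amalg_proj_eq0 x : amalg_projA x = 0 -> amalg_projC x = 0 -> x = 0.
Proof.
move=> xA /(congr1 val) xC; apply: val_inj; rewrite [RHS]rmorph0.
by rewrite [LHS]surjective_pairing [(val x).1]xA [(val x).2]xC rmorph0.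
Qed.

Lemma amalg_proj_eq0C x : amalg_projC x = 0 -> amalg_projA x = 0 -> x = 0.
Proof. by move=> xC xA; apply: amalg_proj_eq0. Qed.

Lemma fg_kernel_projA :
  fg_kernel amalg_projA <-> fg_ideal (ideal_in_image_add f J).
Proof.
have [t tK] := amalg_projC_section.
apply: fg_kernel_image amalg_proj_eq0 _ tK _ _ => y.
split=> [Jy|[x x0 <-]].
  have yP : (0, val y) \in amalg f J.
    by have := amalg_pair 0 Jy; rewrite rmorph0 add0r.
  by exists (Subring yP) => //; apply: val_inj.
by have := amalg_subJ x; rewrite [(val x).1]x0 rmorph0 subr0.
Qed.

Lemma fg_kernel_projC : fg_kernel amalg_projC <-> fg_ideal [preim f of J].
Proof.
apply: fg_kernel_image amalg_proj_eq0C _ amalg_diagK _ _ => a.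
split=> [Ja|[x /(congr1 val) x0 <-]].
  (* The second coordinate 0 is written as f(a) + (-f(a)). *)
  have aP : (a, 0) \in amalg f J.
    have JNfa : - f a \in J by rewrite rpredN.
    by have := amalg_pair a JNfa; rewrite subrr.
  by exists (Subring aP) => //; apply: val_inj.
by have := amalg_subJ x; rewrite [(val x).2]x0 rmorph0 sub0r rpredN.
Qed.

Lemma regular_fg_kernel_projC :
  regular_ideal (ideal_in_image_add f J) -> fg_syzygies R ->
  fg_kernel amalg_projC.
Proof.
case=> x Jx x_reg syzR.
have xP : (0, val x) \in amalg f J.
  by have := amalg_pair 0 Jx; rewrite rmorph0 add0r.
pose z : R := Subring xP; have zA : amalg_projA z = 0 by [].
have zC : amalg_projC z = x by apply: val_inj.
(* Both sides have zero first coordinate after multiplying by [z]; in the second, [x] can be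
   cancelled. *)
have annz y : amalg_projC y = 0 <-> y * z = 0.
  split=> [y0|/(congr1 amalg_projC)].
    apply: amalg_proj_eq0; rewrite rmorphM.
      by rewrite [X in _ * X]zA mulr0.
    by rewrite [X in X * _]y0 mul0r.
  rewrite rmorphM [X in _ * X]zC [RHS]rmorph0 mulrC => xy0.
  by apply: x_reg; rewrite [LHS]xy0 mulr0.
(* Relations of the one-element tuple [z] are exactly its annihilator, so their generating matrix is
   already a column of kernel generators. *)
have [m [g [g0 gP]]] := syzR 1%N z%:M; exists m, g; split=> [|y /annz yz].
  apply/matrixP=> i j; rewrite !mxE; apply/annz.
  by move/matrixP: g0 => /(_ i j); rewrite mul_mx_scalar !mxE mulrC.
by apply: gP; rewrite mul_mx_scalar scale_scalar_mx mulrC yz raddf0.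
Qed.

End Amalgamation.

Theorem theorem2p2 (A : comPzRingType) (B : comNzRingType)
    (f : {rmorphism A -> B}) (J : idealr B) :
  (* (1) *)
  (coherent (subring_of (amalg f J)) -> coherent A)
  /\
  (* (2) *)
  (fg_ideal (ideal_in_image_add f J) -> fg_ideal [preim f of J] ->
     (coherent (subring_of (amalg f J)) <->
      coherent A /\ coherent (subring_of (image_add f J))))
  /\
  (* (3) *)
  (regular_ideal (ideal_in_image_add f J) ->
   fg_ideal (ideal_in_image_add f J) ->
     (coherent (subring_of (amalg f J)) <->
      [/\ coherent A, coherent (subring_of (image_add f J)) &
          fg_ideal [preim f of J]])).
Proof.
have [t tK] := amalg_projC_section f J.
have cohA : coherent (subring_of (amalg f J)) -> coherent A.
  move=> /coherentE cohR; apply/coherentE.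
  exact: fg_syzygies_retract (amalg_diagK f J) cohR.
have cohC : fg_ideal [preim f of J] -> coherent (subring_of (amalg f J)) ->
    coherent (subring_of (image_add f J)).
  move=> /fg_kernel_projC kC /coherentE cohR; apply/coherentE.
  exact: fg_syzygies_quotient tK cohR kC.
have cohR : fg_ideal (ideal_in_image_add f J) -> fg_ideal [preim f of J] ->
    coherent A -> coherent (subring_of (image_add f J)) ->
    coherent (subring_of (amalg f J)).
  move=> /fg_kernel_projA kA /fg_kernel_projC kC /coherentE syzA /coherentE syzC.
  apply/coherentE.
  have proj_inj := @amalg_proj_eq0 _ _ f J.
  exact: (fg_syzygies_glue proj_inj tK (amalg_diagK f J) kA kC syzA syzC).
split=> //; split=> [fgJ fgK|regJ fgJ].
  by split=> [coh|[]]; [split; [exact: cohA|exact: cohC]|exact: cohR].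
split=> [coh|[cA cC fgK]]; last exact: cohR.
(* Regularity of J supplies the hypothesis on the preimage of J, after which the argument of (2)
   applies. *)
have fgK : fg_ideal [preim f of J].
  by apply/fg_kernel_projC/regular_fg_kernel_projC => //; apply/coherentE.
by split; [exact: cohA|exact: cohC|].
Qed.
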